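(* Consider the primal-dual interior-point KKT (Newton) system $$ \begin{bmatrix} M^{\mathrm v} & M^{\mathrm{vL}} & M^{\mathrm{vC}}\\ M^{\mathrm{Lv}} & M^{\mathrm L} & 0\\ M^{\mathrm{Cv}} & 0 & M^{\mathrm C}\end{bmatrix} \begin{bmatrix}\Delta z^{\mathrm v}\\ \Delta z^{\mathrm L}\\ \Delta z^{\mathrm C}\end{bmatrix} =-\begin{bmatrix} r^{\mathrm v}\\ r^{\mathrm L}\\ r^{\mathrm C}\end{bmatrix} \qquad (\ast) $$ of the fixed-order intersection coordination problem with $N$ vehicles and $L$ lanes, with the blocks described in the context. Define, for $l=1,\dots,L$, $$\bar M^{\mathrm L}_l := M^{\mathrm L}_l-\sum_{i\in\mathcal I^{\mathrm v}_l} M^{\mathrm{Lv}}_{l,i}(M^{\mathrm v}_i)^{-1}M^{\mathrm{vL}}_{i,l},\qquad \bar M^{\mathrm L}:=\mathrm{blockdiag}(\bar M^{\mathrm L}_1,\dots,\bar M^{\mathrm L}_L),$$ $$\bar M^{\mathrm{LC}}_l:=-\sum_{i\in\mathcal I^{\mathrm v}_l}M^{\mathrm{Lv}}_{l,i}(M^{\mathrm v}_i)^{-1}M^{\mathrm{vC}}_i,\qquad \bar M^{\mathrm{CL}}_l:=(\bar M^{\mathrm{LC}}_l)^\top,$$ $$\bar M^{\mathrm C}:=M^{\mathrm C}-\sum_{i=1}^N M^{\mathrm{Cv}}_i(M^{\mathrm v}_i)^{-1}M^{\mathrm{vC}}_i,$$ $$\bar r^{\mathrm C}:=r^{\mathrm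 C}-\sum_{i=1}^N M^{\mathrm{Cv}}_i(M^{\mathrm v}_i)^{-1}r^{\mathrm v}_i,\qquad \bar r^{\mathrm L}_l:=r^{\mathrm L}_l-\sum_{i\in\mathcal I^{\mathrm v}_l}M^{\mathrm{Lv}}_{l,i}(M^{\mathrm v}_i)^{-1}r^{\mathrm v}_i,$$ and assume that all matrices $M^{\mathrm v}_i$ ($i=1,\dots,N$) and $\bar M^{\mathrm L}_l$ ($l=1,\dots,L$) are invertible. Then $(\ast)$ can be solved as the following sequence of equations, i.e. $(\Delta z^{\mathrm v},\Delta z^{\mathrm L},\Delta z^{\mathrm C})$ satisfies $(\ast)$ if and only if it satisfies: 1. (intersection level) $$\Big(\bar M^{\mathrm C}-\sum_{l=1}^L\bar M^{\mathrm{CL}}_l(\bar M^{\mathrm L}_l)^{-1}\bar M^{\mathrm{LC}}_l\Big)\Delta z^{\mathrm C}=-\bar r^{\mathrm C}+\sum_{l=1}^L\bar M^{\mathrm{CL}}_l(\bar M^{\mathrm L}_l)^{-1}\bar r^{\mathrm L}_l;$$ 2. (lane level) for every $l\in\{1,\dots,L\}$, $$\bar M^{\mathrm L}_l\,\Delta z^{\mathrm L}_l=-\bar r^{\mathrm L}_l-\bar M^{\mathrm{LC}}_l\,\Delta z^{\mathrm C};$$ 3. (vehicle level) for every $i\in\{1,\dots,N\}$, $$M^{\mathrm v}_i\,\Delta z^{\mathrm v}_i=-r^{\mathrm v}_i-\begin{bmatrix}M^{\mathrm{vL}}_i & M^{\mathrm{vC}}_i\end{bmatrix}\begin{bmatrix}\Delta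 z^{\mathrm L}\\ \Delta z^{\mathrm C}\end{bmatrix}.$$
   Context: **Problem.** There are $N$ vehicles, $\mathcal I^{\mathrm v}=\{1,\dots,N\}$, and $L$ lanes, $\mathcal I^{\mathrm L}=\{1,\dots,L\}$. $\mathcal I^{\mathrm v}$ is the disjoint union of the sets $\mathcal I^{\mathrm v}_l$, $l\in\mathcal I^{\mathrm L}$, of vehicles on lane $l$ (ordered so that vehicle $i+1$ precedes vehicle $i$). Vehicle $i$ has primal variables $y_i=(w_i,T_i)$. Here $w_i$ collects its discretized states (including positions $p_{i,k}$, $k=0,\dots,K$, which form $p_i$) and its controls, and $T_i$ collects its entry and exit times $t^{\mathrm{in}}_{i,r},t^{\mathrm{out}}_{i,r}$ for the conflict zones $r$ it crosses. Write $T=(T_1,\dots,T_N)$ and $y=(y_1,\dots,y_N)$. The nonlinear program is $$\min_y\ \sum_{i=1}^N J_i(w_i)\quad\text{s.t.}\quad g_i(w_i,T_i)=0,\ \ h^{\mathrm P}_i(w_i)\le 0\ (i\in\mathcal I^{\mathrm v}),\ \ h^{\mathrm L}_l\le 0\ (l\in\mathcal I^{\mathrm L}),\ \ h^{\mathrm C}(T)\le 0,$$ where all functions are twice differentiable. The function $h^{\mathrm L}_l$ has components $p_{i,k}+\delta_i-p_{i+1,k}$ for $i,i+1\in\mathcal I^{\mathrm v}_l$, $k=0,\dots,K$ (rear-end collision avoidance), with constants $\delta_i>0$. The function $h^{\mathrm C}(T)$ has components $t^{\mathrm{out}}_{i,r}-t^{\mathrm{in}}_{j,r}$ for $(i,j,r)$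 in a given finite index set (side collision avoidance, fixed crossing order). In particular $h^{\mathrm L}_l$ depends only on the variables of vehicles in $\mathcal I^{\mathrm v}_l$. The multipliers are $\lambda_i,\mu^{\mathrm P}_i,\mu^{\mathrm L}_l,\mu^{\mathrm C}$. The inequality constraints have slacks $s^{\mathrm P}_i,s^{\mathrm L}_l,s^{\mathrm C}$. All $\mu$ and $s$ are componentwise strictly positive at the current iterate. $\tau>0$ is the barrier parameter, $\mathbf 1$ is the all-ones vector, and $\mathrm D(s)$ is the diagonal matrix with diagonal $s$. $\nabla_y f$ denotes the transposed Jacobian of $f$. $\mathcal L$ is the Lagrangian $$\mathcal L=\sum_i J_i+\sum_i\lambda_i^\top g_i+\sum_i(\mu_i^{\mathrm P})^\top(h_i^{\mathrm P}+s_i^{\mathrm P})+\sum_l(\mu_l^{\mathrm L})^\top(h_l^{\mathrm L}+s_l^{\mathrm L})+(\mu^{\mathrm C})^\top(h^{\mathrm C}+s^{\mathrm C}).$$ **Variables and residuals.** - $z^{\mathrm v}=(z^{\mathrm v}_1,\dots,z^{\mathrm v}_N)$ with $z^{\mathrm v}_i=(y_i,\lambda_i,\mu^{\mathrm P}_i,s^{\mathrm P}_i)$. - $z^{\mathrm L}=(z^{\mathrm L}_1,\dots,z^{\mathrm L}_L)$ with $z^{\mathrm L}_l=(\mu^{\mathrm L}_l,s^{\mathrm L}_l)$. - $z^{\mathrm C}=(\mu^{\mathrm C},s^{\mathrm C})$. - $r^{\mathrm v}=(r^{\mathrm v}_1,\dots,r^{\mathrm v}_N)$ with $r^{\mathrm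 v}_i=(\nabla_{y_i}\mathcal L,\ g_i,\ h^{\mathrm P}_i+s^{\mathrm P}_i,\ \mu^{\mathrm P}_i-\mathrm D(s^{\mathrm P}_i)^{-1}\mathbf 1\tau)$. - $r^{\mathrm L}=(r^{\mathrm L}_1,\dots,r^{\mathrm L}_L)$ with $r^{\mathrm L}_l=(h^{\mathrm L}_l+s^{\mathrm L}_l,\ \mu^{\mathrm L}_l-\mathrm D(s^{\mathrm L}_l)^{-1}\mathbf 1\tau)$. - $r^{\mathrm C}=(h^{\mathrm C}+s^{\mathrm C},\ \mu^{\mathrm C}-\mathrm D(s^{\mathrm C})^{-1}\mathbf 1\tau)$. The steps $\Delta z^{\mathrm v},\Delta z^{\mathrm L},\Delta z^{\mathrm C}$ are partitioned in the same way. **Matrix blocks.** $M^{\mathrm v}=\mathrm{blockdiag}(M^{\mathrm v}_1,\dots,M^{\mathrm v}_N)$ with $$M^{\mathrm v}_i=\begin{bmatrix}B_i&\nabla_{y_i}g_i&\nabla_{y_i}h^{\mathrm P}_i&0\\ \nabla_{y_i}g_i^\top&0&0&0\\ \nabla_{y_i}{h^{\mathrm P}_i}^\top&0&0&I\\ 0&0&I&\mathrm D(s^{\mathrm P}_i)^{-1}\mathrm D(\mu^{\mathrm P}_i)\end{bmatrix},$$ where $B_i$ is a symmetric matrix (the Hessian of $\mathcal L$ with respect to $y_i$, or an approximation of it). $M^{\mathrm L}=\mathrm{blockdiag}(M^{\mathrm L}_1,\dots,M^{\mathrm L}_L)$ with $$M^{\mathrm L}_l=\begin{bmatrix}0&I\\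 I&\mathrm D(s^{\mathrm L}_l)^{-1}\mathrm D(\mu^{\mathrm L}_l)\end{bmatrix},\qquad M^{\mathrm C}=\begin{bmatrix}0&I\\ I&\mathrm D(s^{\mathrm C})^{-1}\mathrm D(\mu^{\mathrm C})\end{bmatrix}.$$ $M^{\mathrm{Lv}}$ is the Jacobian of $r^{\mathrm L}$ with respect to $z^{\mathrm v}$, with blocks $M^{\mathrm{Lv}}_{l,i}$ (rows of lane $l$, columns of vehicle $i$): $$M^{\mathrm{Lv}}_{l,i}=\begin{bmatrix}\nabla_{y_i}{h^{\mathrm L}_l}^\top&0&0&0\\0&0&0&0\end{bmatrix}.$$ Thus $M^{\mathrm{Lv}}_{l,i}=0$ whenever $i\notin\mathcal I^{\mathrm v}_l$. $M^{\mathrm{Cv}}=[M^{\mathrm{Cv}}_1,\dots,M^{\mathrm{Cv}}_N]$ is the Jacobian of $r^{\mathrm C}$ with respect to $z^{\mathrm v}$, where $M^{\mathrm{Cv}}_i$ consists of the columns of vehicle $i$ and has the analogous form with $h^{\mathrm C}$ in place of $h^{\mathrm L}_l$. $M^{\mathrm{vL}}=(M^{\mathrm{Lv}})^\top$ has blocks $M^{\mathrm{vL}}_{i,l}=(M^{\mathrm{Lv}}_{l,i})^\top$ and block rows $M^{\mathrm{vL}}_i=[M^{\mathrm{vL}}_{i,1},\dots,M^{\mathrm{vL}}_{i,L}]$. $M^{\mathrm{vC}}=(M^{\mathrm{Cv}})^\top$ has block rows $M^{\mathrm{vC}}_i=(M^{\mathrm{Cv}}_i)^\top$. *)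

(* Defs.v *)
From HB Require Import structures.
From mathcomp Require Import all_boot all_order all_algebra.
From mathcomp Require Import all_classical all_reals all_analysis.

Set Implicit Arguments.
Unset Strict Implicit.
Unset Printing Implicit Defensive.

Import Order.TTheory GRing.Theory Num.Theory.
Import numFieldNormedType.Exports.

Local Open Scope ring_scope.

(* The library's [jacobian] acts on row vectors ('D_v f a = v *m 'J f a), so it
   is already the transpose of the usual Jacobian: [grad f x] is the n x m
   matrix with entries d f_j / d x_i. *)
Definition grad (R : realType) (n m : nat) (f : 'cV[R]_n -> 'cV[R]_m)
    (x : 'cV[R]_n) : 'M[R]_(n, m) :=
  jacobian (fun u : 'rV[R]_n => (f u^T)^T) x^T.

Definition twice_differentiable (R : realType) (n m : nat)
    (f : 'cV[R]_n -> 'cV[R]_m) : Prop :=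
  (forall x, differentiable f x) /\ (forall x, differentiable (grad f) x).

Definition scalar_fun (R : realType) (n : nat) (f : 'cV[R]_n -> R) :
    'cV[R]_n -> 'cV[R]_1 :=
  fun x => (f x)%:M.

Definition D (R : realType) (n : nat) (s : 'cV[R]_n) : 'M[R]_n := diag_mx s^T.

Definition all_pos (R : realType) (n : nat) (v : 'cV[R]_n) : Prop :=
  forall k, 0 < v k 0.

(* Vehicle i has primal variable y_i = col_mx w_i T_i. Position p_{i,k} is the
   coordinate [posn i k] of w_i. T_i stacks the entry times over the exit
   times, one of each per conflict zone in [crossed i]. A triple (i, j, r) in
   [crossing_order] means that i leaves zone r before j enters it. *)
Record problem (R : realType) := Problem {
  nveh : nat;
  nlane : nat;
  nzone : nat;
  horizon : nat;
  lane : 'I_nlane -> {set 'I_nveh};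
  lane_disjoint : forall l l', l != l' -> [disjoint lane l & lane l'];
  lane_cover : forall i, exists l, i \in lane l;
  crossed : 'I_nveh -> {set 'I_nzone};
  nw : 'I_nveh -> nat;
  posn : forall i, 'I_horizon.+1 -> 'I_(nw i);
  posn_inj : forall i, injective (posn i);
  neq : 'I_nveh -> nat;
  nineq : 'I_nveh -> nat;
  cost : forall i, 'cV[R]_(nw i) -> R;
  g : forall i, 'cV[R]_(nw i + (#|crossed i| + #|crossed i|)) -> 'cV[R]_(neq i);
  hP : forall i, 'cV[R]_(nw i) -> 'cV[R]_(nineq i);
  delta : 'I_nveh -> R;
  delta_gt0 : forall i, 0 < delta i;
  crossing_order : {set 'I_nveh * 'I_nveh * 'I_nzone};
  order_crossed : forall c, c \in crossing_order ->
    c.2 \in crossed c.1.1 /\ c.2 \in crossed c.1.2;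
  cost_diff2 : forall i, twice_differentiable (scalar_fun (@cost i));
  g_diff2 : forall i, twice_differentiable (@g i);
  hP_diff2 : forall i, twice_differentiable (@hP i)
}.

Section Problem.

Variables (R : realType) (P : problem R).

Definition nT (i : 'I_(nveh P)) : nat := #|crossed i| + #|crossed i|.
Definition ny (i : 'I_(nveh P)) : nat := nw i + nT i.

Definition position (i : 'I_(nveh P)) (w : 'cV[R]_(nw i))
    (k : 'I_(horizon P).+1) : R :=
  w (posn i k) 0.

Definition t_in (i : 'I_(nveh P)) (r : 'I_(nzone P)) (r_i : r \in crossed i)
    (T : 'cV[R]_(nT i)) : R :=
  usubmx T (enum_rank_in r_i r) 0.

Definition t_out (i : 'I_(nveh P)) (r : 'I_(nzone P)) (r_i : r \in crossed i)
    (T : 'cV[R]_(nT i)) : R :=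
  dsubmx T (enum_rank_in r_i r) 0.

(* Triples (i, i + 1, k) with i and i + 1 both on lane l. *)
Definition rear_end (l : 'I_(nlane P)) :
    {set 'I_(nveh P) * 'I_(nveh P) * 'I_(horizon P).+1} :=
  [set c | [&& c.1.1 \in lane l, c.1.2 \in lane l
             & nat_of_ord c.1.2 == (nat_of_ord c.1.1).+1]].

Definition nL (l : 'I_(nlane P)) : nat := #|rear_end l|.
Definition nC : nat := #|crossing_order P|.

Definition hL (l : 'I_(nlane P)) (y : forall i, 'cV[R]_(ny i)) : 'cV[R]_(nL l) :=
  \col_e (let: (i, j, k) := enum_val e in
          position (usubmx (y i)) k + delta i - position (usubmx (y j)) k).

Definition hC (T : forall i, 'cV[R]_(nT i)) : 'cV[R]_nC :=
  \col_e (let c := enum_val e in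
          let crossed_c := order_crossed (enum_valP e) in
          t_out (proj1 crossed_c) (T c.1.1) - t_in (proj2 crossed_c) (T c.1.2)).

Record iterate := Iterate {
  yv : forall i, 'cV[R]_(ny i);
  lam : forall i : 'I_(nveh P), 'cV[R]_(neq i);
  muP : forall i : 'I_(nveh P), 'cV[R]_(nineq i);
  sP : forall i : 'I_(nveh P), 'cV[R]_(nineq i);
  muL : forall l, 'cV[R]_(nL l);
  sL : forall l, 'cV[R]_(nL l);
  muC : 'cV[R]_nC;
  sC : 'cV[R]_nC
}.

Definition strictly_positive (z : iterate) : Prop :=
  [/\ forall i, all_pos (muP z i) /\ all_pos (sP z i),
      forall l, all_pos (muL z l) /\ all_pos (sL z l)
    & all_pos (muC z) /\ all_pos (sC z)].

Definition hPy (i : 'I_(nveh P)) (yi : 'cV[R]_(ny i)) : 'cV[R]_(nineq i) :=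
  hP (usubmx yi).

Definition hCy (y : forall i, 'cV[R]_(ny i)) : 'cV[R]_nC :=
  hC (fun i => dsubmx (y i)).

Definition dotv (n : nat) (u v : 'cV[R]_n) : R := (u^T *m v) 0 0.

Definition Lagrangian (z : iterate) : R :=
  \sum_i cost (usubmx (yv z i))
  + \sum_i dotv (lam z i) (g (yv z i))
  + \sum_i dotv (muP z i) (hPy (yv z i) + sP z i)
  + \sum_l dotv (muL z l) (hL l (yv z) + sL z l)
  + dotv (muC z) (hCy (yv z) + sC z).

Definition with_y (z : iterate) (y' : forall i, 'cV[R]_(ny i)) : iterate :=
  Iterate y' (lam z) (muP z) (sP z) (muL z) (sL z) (muC z) (sC z).

(* Partial gradient with respect to y_i of a function of all of y. *)
Definition grad_y (m : nat) (f : (forall i, 'cV[R]_(ny i)) -> 'cV[R]_m)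
    (y : forall i, 'cV[R]_(ny i)) (i : 'I_(nveh P)) : 'M[R]_(ny i, m) :=
  grad (fun yi => f (dfwith y i yi)) (y i).

(* Sizes of the vehicle blocks (y_i, lam_i, muP_i, sP_i), of the lane blocks
   (muL_l, sL_l) and of the block (muC, sC). *)
Definition dv (i : 'I_(nveh P)) : nat := ny i + (neq i + (nineq i + nineq i)).
Definition dL (l : 'I_(nlane P)) : nat := nL l + nL l.
Definition dC : nat := nC + nC.

Section Newton.

Variables (z : iterate) (tau : R) (B : forall i, 'M[R]_(ny i)).

Definition perturbed (n : nat) (mu s : 'cV[R]_n) : 'cV[R]_n :=
  mu - tau *: (invmx (D s) *m const_mx 1).

Definition rv (i : 'I_(nveh P)) : 'cV[R]_(dv i) :=
  col_mx (grad_y (fun y' => (Lagrangian (with_y z y'))%:M) (yv z) i)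
 (col_mx (g (yv z i))
 (col_mx (hPy (yv z i) + sP z i)
         (perturbed (muP z i) (sP z i)))).

Definition rL (l : 'I_(nlane P)) : 'cV[R]_(dL l) :=
  col_mx (hL l (yv z) + sL z l) (perturbed (muL z l) (sL z l)).

Definition rC : 'cV[R]_dC :=
  col_mx (hCy (yv z) + sC z) (perturbed (muC z) (sC z)).

Definition Mv_ (i : 'I_(nveh P)) : 'M[R]_(dv i) :=
  let Gg := grad (@g R P i) (yv z i) in
  let Gh := grad (@hPy i) (yv z i) in
  col_mx (row_mx (B i) (row_mx Gg (row_mx Gh   0)))
 (col_mx (row_mx Gg^T  (row_mx 0  (row_mx 0    0)))
 (col_mx (row_mx Gh^T  (row_mx 0  (row_mx 0    1%:M)))
         (row_mx 0     (row_mx 0  (row_mx 1%:M (invmx (D (sP z i)) *m D (muP z i))))))).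

Definition ML_ (l : 'I_(nlane P)) : 'M[R]_(dL l) :=
  block_mx 0 1%:M 1%:M (invmx (D (sL z l)) *m D (muL z l)).

Definition MC : 'M[R]_dC :=
  block_mx 0 1%:M 1%:M (invmx (D (sC z)) *m D (muC z)).

Definition MLv_ (l : 'I_(nlane P)) (i : 'I_(nveh P)) : 'M[R]_(dL l, dv i) :=
  block_mx (grad_y (hL l) (yv z) i)^T 0 0 0.

Definition MCv_ (i : 'I_(nveh P)) : 'M[R]_(dC, dv i) :=
  block_mx (grad_y hCy (yv z) i)^T 0 0 0.

Definition MvL_ (i : 'I_(nveh P)) (l : 'I_(nlane P)) : 'M[R]_(dv i, dL l) :=
  (MLv_ l i)^T.

Definition MvC_ (i : 'I_(nveh P)) : 'M[R]_(dv i, dC) := (MCv_ i)^T.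

Definition Mv : 'M[R]_(\sum_i dv i) := \mxdiag_i Mv_ i.
Definition ML : 'M[R]_(\sum_l dL l) := \mxdiag_l ML_ l.
Definition MLv : 'M[R]_(\sum_l dL l, \sum_i dv i) := \mxblock_(l, i) MLv_ l i.
Definition MCv : 'M[R]_(dC, \sum_i dv i) := \mxrow_i MCv_ i.
Definition MvL : 'M[R]_(\sum_i dv i, \sum_l dL l) := MLv^T.
Definition MvC : 'M[R]_(\sum_i dv i, dC) := MCv^T.

Definition KKT_matrix :
    'M[R]_(\sum_i dv i + (\sum_l dL l + dC)) :=
  col_mx (row_mx Mv  (row_mx MvL MvC))
 (col_mx (row_mx MLv (row_mx ML  0))
         (row_mx MCv (row_mx 0   MC))).

Definition KKT_residual : 'cV[R]_(\sum_i dv i + (\sum_l dL l + dC)) :=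
  col_mx (\mxcol_i rv i) (col_mx (\mxcol_l rL l) rC).

Definition MLbar (l : 'I_(nlane P)) : 'M[R]_(dL l) :=
  ML_ l - \sum_(i in lane l) MLv_ l i *m invmx (Mv_ i) *m MvL_ i l.

Definition MLCbar (l : 'I_(nlane P)) : 'M[R]_(dL l, dC) :=
  - \sum_(i in lane l) MLv_ l i *m invmx (Mv_ i) *m MvC_ i.

Definition MCLbar (l : 'I_(nlane P)) : 'M[R]_(dC, dL l) := (MLCbar l)^T.

Definition MCbar : 'M[R]_dC :=
  MC - \sum_i MCv_ i *m invmx (Mv_ i) *m MvC_ i.

Definition rCbar : 'cV[R]_dC :=
  rC - \sum_i MCv_ i *m invmx (Mv_ i) *m rv i.

Definition rLbar (l : 'I_(nlane P)) : 'cV[R]_(dL l) :=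
  rL l - \sum_(i in lane l) MLv_ l i *m invmx (Mv_ i) *m rv i.

End Newton.

End Problem.

(* Main.v *)
(* Two nested Schur complements. Given the vehicle rows, the vehicle steps can
   be substituted into the lane and intersection rows. Since the rear-end
   constraints of a lane involve only its own vehicles and lanes are disjoint,
   this elimination creates no coupling between distinct lanes: the lane block
   stays block diagonal, and the lane steps can be eliminated in turn. *)
Require Import Defs.
From mathcomp Require Import all_boot all_order all_algebra.
From mathcomp Require Import reals.
From mathcomp Require Import mathcomp_extra boolp functions derive.
Import Order.TTheory GRing.Theory Num.Theory.
Local Open Scope ring_scope.

Lemma mulmx_eq_invmx {F : fieldType} {n m : nat} (A : 'M[F]_n)
    (x b : 'M[F]_(n, m)) :
  A \in unitmx -> A *m x = b <-> x = invmx A *m b.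
Proof. by move=> A_unit; split=> [<-|->]; rewrite (mulKmx, mulKVmx). Qed.

(** Rearranged, the hypothesis says that [S + Y + r] equals [X + Z + rbar]: eliminating the vehicle
    steps does not change the residual of a row. Here [S] is the vehicle part of the row, [X - Y]
    the Schur correction of its diagonal term and [Z] the coupling created by fill-in. *)
Lemma schur_row {V : zmodType} (S r rbar X Y Z : V) :
  S = rbar - r + (X - Y) + Z -> S + Y = - r <-> X + Z = - rbar.
Proof.
move=> ->; rewrite addrAC -(addrA (rbar - r)) subrK -addrA (addrC rbar) -addrA.
split=> [|->]; last by rewrite subrr addr0.
by rewrite -{2}[- r]addr0 => /addrI/eqP; rewrite addrC addr_eq0 => /eqP.
Qed.

Section BlockElimination.

Variables (F : fieldType) (N L c : nat) (p : 'I_N -> nat) (q : 'I_L -> nat).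
Variables (lane : 'I_L -> {set 'I_N}).
Variables (A : forall i, 'M[F]_(p i)) (K : forall l i, 'M[F]_(q l, p i)).
Variables (C : forall i, 'M[F]_(c, p i)) (Q : forall l, 'M[F]_(q l)).
Variables (E : 'M[F]_c).
Variables (rv : forall i, 'cV[F]_(p i)) (rl : forall l, 'cV[F]_(q l)).
Variables (rc : 'cV[F]_c).
Variables (x : forall i, 'cV[F]_(p i)) (u : forall l, 'cV[F]_(q l)).
Variables (w : 'cV[F]_c).

Hypothesis lane_disj : forall l l', l != l' -> [disjoint lane l & lane l'].
Hypothesis A_unit : forall i, A i \in unitmx.
Hypothesis A_sym : forall i, (A i)^T = A i.
Hypothesis K_lane : forall l i, i \notin lane l -> K l i = 0.

Let Qbar l := Q l - \sum_(i in lane l) K l i *m invmx (A i) *m (K l i)^T.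
Let Kbar l := - \sum_(i in lane l) K l i *m invmx (A i) *m (C i)^T.
Let Ebar := E - \sum_i C i *m invmx (A i) *m (C i)^T.
Let rcbar := rc - \sum_i C i *m invmx (A i) *m rv i.
Let rlbar l := rl l - \sum_(i in lane l) K l i *m invmx (A i) *m rv i.

Let vehicle_rows := forall i,
  A i *m x i = - rv i - (\sum_l (K l i)^T *m u l + (C i)^T *m w).

(** A vehicle lies on one lane only, so every other [K l' i] vanishes. This is what prevents fill-in
    between distinct lanes. *)
Lemma lane_coupling l i : i \in lane l ->
  \sum_l' (K l' i)^T *m u l' = (K l i)^T *m u l.
Proof.
move=> il; rewrite (bigD1 l) //= big1 ?addr0 // => l' ne.
by rewrite K_lane ?trmx0 ?mul0mx // (disjointFl (lane_disj _ _ ne)).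
Qed.

Lemma lane_row_elim l : vehicle_rows ->
  \sum_i K l i *m x i + Q l *m u l = - rl l <->
  Qbar l *m u l + Kbar l *m w = - rlbar l.
Proof.
move=> vr; apply: schur_row; rewrite -mulmxBl /rlbar /Qbar /Kbar.
(* The original terms [rl l] and [Q l] cancel, leaving only the correction sums over the lane. *)
rewrite ![_ - \sum_(i in _) _]addrC !addrK.
rewrite !mulNmx !mulmx_suml -!opprD -!big_split -sumrN /=.
rewrite (bigID [in lane l]) /= [X in _ + X]big1 ?addr0 => [|i /K_lane->];
  last exact: mul0mx.
apply: eq_bigr => i il.
have /(mulmx_eq_invmx _ _ _ (A_unit i)) -> := vr i.
by rewrite (lane_coupling _ _ il) -opprD !mulmxN !mulmxDr !mulmxA addrA.
Qed.

(** Substitution gives the lane steps the coefficients [C i *m invmx (A i) *m (K l i)^T]; symmetry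
    of [A i] is what identifies their negated sum with the transpose of [Kbar l]. *)
Lemma intersection_row_elim : vehicle_rows ->
  \sum_i C i *m x i + E *m w = - rc <->
  Ebar *m w + \sum_l (Kbar l)^T *m u l = - rcbar.
Proof.
move=> vr; apply: schur_row; rewrite -mulmxBl /rcbar /Ebar.
have -> : \sum_l (Kbar l)^T *m u l =
    - \sum_i C i *m invmx (A i) *m \sum_l (K l i)^T *m u l.
  (* Each lane sum is extended by zero terms to all vehicles, so that the two summations can be
     exchanged. *)
  transitivity (- \sum_l \sum_i C i *m invmx (A i) *m ((K l i)^T *m u l)).
    rewrite -sumrN; apply: eq_bigr => l _.
    rewrite /Kbar linearN mulNmx raddf_sum mulmx_suml /=; congr (- _).
    rewrite [RHS](bigID [in lane l]) /= [X in _ + X]big1 ?addr0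
      => [|i /K_lane->];
      last by rewrite trmx0 mul0mx mulmx0.
    apply: eq_bigr => i _.
    by rewrite !trmx_mul trmxK trmx_inv A_sym !mulmxA.
  rewrite exchange_big; congr (- _).
  by apply: eq_bigr => i _; rewrite mulmx_sumr.
rewrite ![_ - \sum_i _]addrC !addrK.
rewrite !mulNmx !mulmx_suml -!opprD -!big_split -sumrN /=.
apply: eq_bigr => i _.
have /(mulmx_eq_invmx _ _ _ (A_unit i)) -> := vr i.
by rewrite -opprD !mulmxN !mulmxDr !mulmxA addrCA.
Qed.

(** The vehicle rows occur on both sides, so they may be assumed while the lane and intersection
    rows are transformed. *)
Lemma two_level_elimination : (forall l, Qbar l \in unitmx) ->
  [/\ vehicle_rows,
      forall l, \sum_i K l i *m x i + Q l *m u l = - rl l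
    & \sum_i C i *m x i + E *m w = - rc] <->
  [/\ (Ebar - \sum_l (Kbar l)^T *m invmx (Qbar l) *m Kbar l) *m w
      = - rcbar + \sum_l (Kbar l)^T *m invmx (Qbar l) *m rlbar l,
      forall l, Qbar l *m u l = - rlbar l - Kbar l *m w
    & vehicle_rows].
Proof.
move=> Qbar_unit.
(* Second Schur complement: the lane equations express [u l] through [invmx (Qbar l)]. *)
have intersection_row : (forall l, Qbar l *m u l = - rlbar l - Kbar l *m w) ->
    Ebar *m w + \sum_l (Kbar l)^T *m u l = - rcbar <->
    (Ebar - \sum_l (Kbar l)^T *m invmx (Qbar l) *m Kbar l) *m w
      = - rcbar + \sum_l (Kbar l)^T *m invmx (Qbar l) *m rlbar l.
  move=> lr.
  have -> : \sum_l (Kbar l)^T *m u l =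
      - (\sum_l (Kbar l)^T *m invmx (Qbar l) *m Kbar l) *m w
      - \sum_l (Kbar l)^T *m invmx (Qbar l) *m rlbar l.
    rewrite mulNmx mulmx_suml -opprD -big_split -sumrN /=.
    apply: eq_bigr => l _.
    have /(mulmx_eq_invmx _ _ _ (Qbar_unit l)) -> := lr l.
    (* Abstraction seals the signs and sums inside these local definitions before products are
       expanded. *)
    move: (Kbar l) (rlbar l) => Kl rl'.
    by rewrite -opprD !mulmxN !mulmxDr !mulmxA addrC.
  by rewrite addrA -mulmxDl; split=> [/(canRL (subrK _))|->]; rewrite ?addrK.
have lane_row l : Qbar l *m u l + Kbar l *m w = - rlbar l <->
    Qbar l *m u l = - rlbar l - Kbar l *m w.
  by split=> [/(canRL (addrK _))|->]; rewrite ?subrK.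
split=> [[vr lr ir]|[ir lr vr]].
  have lr' l : Qbar l *m u l = - rlbar l - Kbar l *m w.
    exact/lane_row/lane_row_elim.
  by split=> //; apply/intersection_row => //; apply/intersection_row_elim.
split=> // [l|]; first exact/lane_row_elim/lane_row.
by apply/intersection_row_elim => //; apply/intersection_row.
Qed.

End BlockElimination.

Lemma mul_mxcol {R : pzSemiRingType} {n m k : nat} {p : 'I_n -> nat}
    (U : forall i, 'M[R]_(p i, m)) (V : 'M[R]_(m, k)) :
  (\mxcol_i U i) *m V = \mxcol_i (U i *m V).
Proof.
by apply/matrixP => i j; rewrite !mxE; apply: eq_bigr => t _; rewrite mxE.
Qed.

Lemma col_row_mxC {T : Type} {m1 m2 n1 n2 : nat} (a : 'M[T]_(m1, n1))
    (b : 'M[T]_(m1, n2)) (c : 'M[T]_(m2, n1)) (d : 'M[T]_(m2, n2)) :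
  col_mx (row_mx a b) (row_mx c d) = row_mx (col_mx a c) (col_mx b d).
Proof. exact: block_mxEh. Qed.

Lemma mul_block3_eq {R : pzRingType} {m1 m2 m3 n1 n2 n3 k : nat}
    (A11 : 'M[R]_(m1, n1)) A12 A13 (A21 : 'M[R]_(m2, n1)) A22 A23
    (A31 : 'M[R]_(m3, n1)) A32 A33
    (X1 : 'M[R]_(n1, k)) (X2 : 'M[R]_(n2, k)) (X3 : 'M[R]_(n3, k)) B1 B2 B3 :
  col_mx (row_mx A11 (row_mx A12 A13))
 (col_mx (row_mx A21 (row_mx A22 A23))
         (row_mx A31 (row_mx A32 A33))) *m col_mx X1 (col_mx X2 X3)
    = - col_mx B1 (col_mx B2 B3) <->
  [/\ A11 *m X1 + (A12 *m X2 + A13 *m X3) = - B1,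
      A21 *m X1 + (A22 *m X2 + A23 *m X3) = - B2
    & A31 *m X1 + (A32 *m X2 + A33 *m X3) = - B3].
Proof.
rewrite !mul_col_mx !mul_row_col !opp_col_mx.
by split=> [/eq_col_mx[? /eq_col_mx[]]|[-> -> ->]].
Qed.

Lemma D_sym {R : realType} {n : nat} (s : 'cV[R]_n) : (D s)^T = D s.
Proof. exact: tr_diag_mx. Qed.

Lemma comm_invmx {F : fieldType} {n : nat} (A B : 'M[F]_n) :
  A *m B = B *m A -> invmx A *m B = B *m invmx A.
Proof.
have [A_unit AB|A_nonunit] := boolP (A \in unitmx); last first.
  (* On a singular matrix [invmx] returns the matrix itself, so the goal is trivial. *)
  by rewrite /invmx (negbTE A_nonunit).
by rewrite -[B in LHS](mulmxK A_unit) -AB !mulmxA mulVmx // mul1mx.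
Qed.

(** Diagonal matrices commute, and commutation passes to the inverse; this undoes the reversal
    caused by transposition. *)
Lemma invD_mul_D_sym {R : realType} {n : nat} (s mu : 'cV[R]_n) :
  (invmx (D s) *m D mu)^T = invmx (D s) *m D mu.
Proof. by rewrite trmx_mul trmx_inv !D_sym -comm_invmx // /D diag_mxC. Qed.

Lemma grad_cst {R : realType} {n m : nat} (f : 'cV[R]_n -> 'cV[R]_m)
    (x : 'cV[R]_n) :
  (forall v v', f v = f v') -> grad f x = 0.
Proof.
move=> f_cst; rewrite /grad /jacobian.
have -> : (fun v : 'rV[R]_n => (f v^T)^T) = cst (f 0)^T.
  by apply/funext => v; rewrite (f_cst _ 0).
by apply/matrixP => i j; rewrite !mxE diff_cst mxE.
Qed.

Section KKT.

Variables (R : realType) (P : problem R) (z : iterate P).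

(** Both vehicles of a triple in [rear_end l] are on lane [l], so [hL l] is constant in [y_i] for
    [i] off the lane and its gradient vanishes. *)
Lemma MLv_out_lane l i : i \notin lane l -> MLv_ z l i = 0.
Proof.
move=> il; rewrite /MLv_ /grad_y grad_cst ?trmx0 ?block_mx0 // => v v'.
apply/colP => e; rewrite !mxE.
have := enum_valP e; case: (enum_val e) => [[j k] t].
rewrite inE /= => /and3P[jl kl _].
have ne a : a \in lane l -> i != a by apply: contraTneq => <-.
by rewrite !dfwithout ?ne.
Qed.

Variable B : forall i : 'I_(nveh P), 'M[R]_(ny i).
Hypothesis B_sym : forall i, (B i)^T = B i.

Lemma Mv_sym i : (Mv_ z B i)^T = Mv_ z B i.
Proof.
rewrite /Mv_ /= !(tr_col_mx, tr_row_mx) !(trmx0, trmx1, trmxK).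
(* The transpose appears as rows of columns; [col_row_mxC] brings [Mv_] itself to that nesting. *)
by rewrite B_sym invD_mul_D_sym !col_row_mxC.
Qed.

(** Splits the assembled system into per-vehicle and per-lane rows, with the coupling terms of the
    vehicle rows moved to the right, as block elimination expects. *)
Lemma KKT_rows (tau : R) dzv dzL dzC :
  KKT_matrix z B *m col_mx (\mxcol_i dzv i) (col_mx (\mxcol_l dzL l) dzC)
    = - KKT_residual z tau
  <->
  [/\ forall i, Mv_ z B i *m dzv i
        = - rv z tau i - (\sum_l MvL_ z i l *m dzL l + MvC_ z i *m dzC),
      forall l, \sum_i MLv_ z l i *m dzv i + ML_ z l *m dzL l = - rL z tau l
    & \sum_i MCv_ z i *m dzv i + MC z *m dzC = - rC z tau].
Proof.
rewrite mul_block3_eq /Mv /MvL /MvC /MLv /ML /MCv tr_mxblock tr_mxrow.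
rewrite !mul_mxdiag_mxcol !mul_mxblock_mxrow mul_mxcol mul_mxrow_mxcol.
rewrite !mul0mx addr0 add0r -!mxcolN -!mxcolD.
split=> [[/eq_mxcolP vr /eq_mxcolP lr ir]|[vr lr ir]]; split=> //.
- by move=> i; apply/(canRL (addrK _))/vr.
- by apply/eq_mxcolP => i; rewrite vr subrK.
- exact/eq_mxcolP.
Qed.

End KKT.

Theorem proposition1 (R : realType) (P : problem R) (z : iterate P) (tau : R)
    (B : forall i : 'I_(nveh P), 'M[R]_(ny i))
    (z_pos : strictly_positive z)
    (tau_gt0 : 0 < tau)
    (B_sym : forall i, (B i)^T = B i)
    (Mv_unit : forall i, Mv_ z B i \in unitmx)
    (MLbar_unit : forall l, MLbar z B l \in unitmx)
    (dzv : forall i : 'I_(nveh P), 'cV[R]_(dv i))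
    (dzL : forall l : 'I_(nlane P), 'cV[R]_(dL l))
    (dzC : 'cV[R]_(dC P)) :
  KKT_matrix z B *m col_mx (\mxcol_i dzv i) (col_mx (\mxcol_l dzL l) dzC)
    = - KKT_residual z tau
  <->
  [/\ (MCbar z B - \sum_l MCLbar z B l *m invmx (MLbar z B l) *m MLCbar z B l)
        *m dzC
      = - rCbar z tau B
        + \sum_l MCLbar z B l *m invmx (MLbar z B l) *m rLbar z tau B l,
      forall l, MLbar z B l *m dzL l = - rLbar z tau B l - MLCbar z B l *m dzC
    & forall i, Mv_ z B i *m dzv i
        = - rv z tau i
          - row_mx (\mxrow_l MvL_ z i l) (MvC_ z i)
              *m col_mx (\mxcol_l dzL l) dzC].
Proof.
have row_vehicle i : row_mx (\mxrow_l MvL_ z i l) (MvC_ z i)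
      *m col_mx (\mxcol_l dzL l) dzC
    = \sum_l MvL_ z i l *m dzL l + MvC_ z i *m dzC.
  by rewrite mul_row_col mul_mxrow_mxcol.
(* [MvL_] and [MvC_] are by definition the transposes of [MLv_] and [MCv_], so the abstract Schur
   complements unfold to the barred matrices. *)
have elim := two_level_elimination _ _ _ _ _ _ (@lane R P) (Mv_ z B) (MLv_ z)
  (MCv_ z) (ML_ z) (MC z) (rv z tau) (rL z tau) (rC z tau) dzv dzL dzC
  (@lane_disjoint R P) Mv_unit (Mv_sym _ _ _ _ B_sym) (MLv_out_lane _ _ _)
  MLbar_unit.
apply: (iff_trans (KKT_rows _ _ _ _ _ _ _ _)); apply: (iff_trans elim).
split=> -[ir lr vr]; split=> // i; first by rewrite row_vehicle vr.
by rewrite vr row_vehicle.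
Qed.
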